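(* For any digraph $D$ of order $n$ with maximum out-degree $\Delta^+$ and minimum in-degree $\delta^-\ge1$, $\gamma_{\times2}(D)\ge\frac{2n}{\Delta^++1}$. Furthermore, equality holds if and only if $D\in\Theta$.
   Context: Digraphs are finite, without loops or multiple arcs (opposite arcs allowed). A vertex dominates itself and its out-neighbours. A double dominating set is a set $S\subseteq V(D)$ such that every vertex is dominated by at least two vertices of $S$ (each vertex outside $S$ has at least two in-neighbours in $S$, each vertex in $S$ has at least one in-neighbour in $S$); $\gamma_{\times2}(D)$ is its minimum size. A digraph is contrafunctional if every vertex has in-degree exactly one. The family $\Theta$: start with a contrafunctional digraph $D'$ with $V(D')=\{v_1,\dots,v_{n'}\}$. Choose an integer $r\ge\Delta^+(D')$ (maximum out-degree of $D'$) such that $q=(r-1)n'$ is even. Add a set of new vertices $U=\{u_1,\dots,u_{q/2}\}$ and new arcs of the form $(v_i,u_j)$ such that (i) every $u_j$ is incident with precisely two such arcs, and (ii) $\deg^+(v_i)=r$ for all $1\le i\le n'$. Then add some arcs among the vertices of $U$ and some arcs from $U$ to $V(D')$, such that $r$ is the maximum out-degree of the resulting digraph. $\Theta$ is the family of all digraphs obtained this way. *)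

(* Defs.v *)
From mathcomp Require Import all_boot all_order all_algebra.

Set Implicit Arguments.
Unset Strict Implicit.
Unset Printing Implicit Defensive.

(* A digraph is an arc relation [e : rel T] on a finite vertex type that is
   irreflexive; [e u v] is the arc (u, v), so opposite arcs are allowed. *)

Definition outdeg (T : finType) (e : rel T) (v : T) : nat := #|[set w | e v w]|.

Definition indeg (T : finType) (e : rel T) (v : T) : nat := #|[set w | e w v]|.

Definition max_outdeg (T : finType) (e : rel T) : nat := \max_(v : T) outdeg e v.

(* Every in-degree is at most [#|T|], so the default value [#|T|] does not
   affect the minimum when [T] is nonempty; it gives 0 when [T] is empty. *)
Definition min_indeg (T : finType) (e : rel T) : nat :=
  \big[minn/#|T|]_(v : T) indeg e v.

Definition dominates (T : finType) (e : rel T) (u v : T) : bool :=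
  (u == v) || e u v.

Definition double_dominating (T : finType) (e : rel T) (S : {set T}) : bool :=
  [forall v, 2 <= #|[set u in S | dominates e u v]|].

(* A double dominating set exists iff [setT] is one, i.e. iff every in-degree
   is positive; the value is meaningful only in that case. *)
Definition gamma_x2 (T : finType) (e : rel T) : nat :=
  #|[arg min_(S < [set: T] | double_dominating e S) #|S|]|.

Definition contrafunctional (T : finType) (e : rel T) : Prop :=
  forall v, indeg e v = 1.

Definition digraph_iso (T1 T2 : finType) (e1 : rel T1) (e2 : rel T2) : Prop :=
  exists2 f : T1 -> T2, bijective f & forall x y, e2 (f x) (f y) = e1 x y.

(* Digraph on the disjoint union of [V] and [U] with arcs [e'] inside [V],
   [a] from [V] to [U], [b] inside [U] and [c] from [U] to [V]. *)
Definition join_arcs (V U : finType) (e' : rel V) (a : V -> U -> bool)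
    (b : rel U) (c : U -> V -> bool) : rel (V + U)%type :=
  fun x y =>
    match x, y with
    | inl v, inl w => e' v w
    | inl v, inr u => a v u
    | inr u, inr w => b u w
    | inr u, inl v => c u v
    end.

(* The digraph obtained before the arcs leaving [U] are added. *)
Definition attach_arcs (V U : finType) (e' : rel V) (a : V -> U -> bool) :
    rel (V + U)%type :=
  join_arcs e' a (fun _ _ => false) (fun _ _ => false).

(* The family Theta, closed under isomorphism.  The truncated subtraction in
   [r - 1] is harmless: a contrafunctional digraph with a vertex has an arc, so
   [r] is at least 1 unless [n'] is 0, and then the product is 0 anyway. *)
Definition Theta (T : finType) (e : rel T) : Prop :=
  exists (n' : nat) (e' : rel 'I_n') (r : nat),
    let q := (r - 1) * n' in
    [/\ irreflexive e', contrafunctional e', max_outdeg e' <= r, ~~ odd q &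
     exists (a : 'I_n' -> 'I_(q./2) -> bool) (b : rel 'I_(q./2))
            (c : 'I_(q./2) -> 'I_n' -> bool),
       [/\ forall j, #|[set i | a i j]| = 2,
           forall i, outdeg (attach_arcs e' a) (inl i) = r,
           irreflexive b,
           max_outdeg (join_arcs e' a b c) = r &
           digraph_iso (join_arcs e' a b c) e]].

(* Main.v *)
(** Count the pairs [(u, v)] with [u] in a double dominating set [S] and [v]
    dominated by [u].  Each [v] contributes at least 2 and each [u] contributes
    [outdeg u + 1 <= Delta + 1], whence [2 n <= |S| (Delta + 1)].  Equality means
    that every vertex is dominated exactly twice and that every vertex of [S]
    has out-degree [Delta]: the digraph induced on [S] is then contrafunctional
    and every vertex outside [S] receives exactly two arcs from [S], which is
    the construction of Theta with [r = Delta]. *)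

Require Import Defs.
From mathcomp Require Import all_boot all_order all_algebra.
From mathcomp Require Import zify.

Set Implicit Arguments.
Unset Strict Implicit.
Unset Printing Implicit Defensive.

(** * Double counting of dominated pairs and the lower bound *)

Section Domination.

Variables (T : finType) (e : rel T).

Lemma outdeg_le_max (v : T) : outdeg e v <= max_outdeg e.
Proof. exact: (leq_bigmax v). Qed.

Lemma min_indeg_le (v : T) : min_indeg e <= indeg e v.
Proof.
(* [minn] has no unit on [nat], so the default [#|T|] gives no monoid structure; the proof goes by
   induction on the list of indices. *)
rewrite /min_indeg; have : v \in index_enum T by rewrite mem_index_enum.
elim: (index_enum T) => //= x s IHs; rewrite inE big_cons geq_min.
by case: eqP => [-> | _ /= /IHs ->]; rewrite ?leqnn ?orbT.
Qed.

Lemma min_indeg_gt0_card : 0 < min_indeg e -> 0 < #|T|.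
Proof.
apply: contraTT; rewrite -!eqn0Ngt => /eqP T0.
(* On an empty vertex type the minimum collapses to its default, which is then 0. *)
by rewrite /min_indeg big_pred0 ?T0 // => v; have := fintype0 v T0.
Qed.

(** Exchange of summation. Without loops, [u] is not among its own out-neighbours, so dominating
    itself accounts for the successor. *)
Lemma sum_dominators (S : {set T}) : irreflexive e ->
  \sum_v #|[set u in S | dominates e u v]| = \sum_(u in S) (outdeg e u).+1.
Proof.
move=> e_irr.
under eq_bigr => v _ do rewrite -sum1dep_card big_mkcondr.
rewrite exchange_big; apply: eq_bigr => u _ /=.
rewrite -big_mkcond sum1dep_card /outdeg.
have -> : [set v | dominates e u v] = u |: [set w | e u w].
  by apply/setP=> v; rewrite !inE /dominates eq_sym.
by rewrite cardsU1 inE e_irr.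
Qed.

Lemma double_dominating_sum (S : {set T}) : double_dominating e S ->
  2 * #|T| <= \sum_v #|[set u in S | dominates e u v]|.
Proof.
move=> /forallP dS; rewrite mulnC -sum_nat_const.
by apply: leq_sum => v _; apply: dS.
Qed.

Lemma sum_outdeg_le (S : {set T}) :
  \sum_(u in S) (outdeg e u).+1 <= #|S| * (max_outdeg e).+1.
Proof. by rewrite -sum_nat_const; apply: leq_sum => u _; apply: outdeg_le_max. Qed.

Lemma double_dominating_card (S : {set T}) :
  irreflexive e -> double_dominating e S ->
  2 * #|T| <= #|S| * (max_outdeg e).+1.
Proof.
move=> e_irr /double_dominating_sum /leq_trans; apply.
by rewrite sum_dominators // sum_outdeg_le.
Qed.

(** Both inequalities of the counting chain become equalities between sums whose terms are already
    ordered, so the terms agree one by one. *)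
Lemma double_dominating_tight (S : {set T}) :
  irreflexive e -> double_dominating e S ->
  #|S| * (max_outdeg e).+1 = 2 * #|T| ->
  (forall v, #|[set u in S | dominates e u v]| = 2) /\
  {in S, forall u, outdeg e u = max_outdeg e}.
Proof.
move=> e_irr dS tight.
have sum_eq : \sum_v #|[set u in S | dominates e u v]| = 2 * #|T|.
  apply/eqP; rewrite eqn_leq double_dominating_sum // andbT.
  by rewrite sum_dominators // -tight sum_outdeg_le.
split=> [v | u uS].
  have : \sum_(v : T) 2 == \sum_v #|[set u in S | dominates e u v]|.
    by rewrite sum_eq sum_nat_const mulnC.
  have := @leqif_sum T xpredT
    (fun v => 2 == #|[set u in S | dominates e u v]|) (fun=> 2) _
    (fun v _ => leqif_eq (forallP dS v)).
  by move=> [_ ->] /forall_inP /(_ v isT) /eqP.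
have : \sum_(u in S) (outdeg e u).+1 == \sum_(u in S) (max_outdeg e).+1.
  by rewrite -sum_dominators // sum_eq sum_nat_const tight.
have le_max w : w \in S -> (outdeg e w).+1 <= (max_outdeg e).+1
    ?= iff ((outdeg e w).+1 == (max_outdeg e).+1).
  by move=> _; apply: leqif_eq; apply: outdeg_le_max.
by have [_ ->] := leqif_sum le_max; move=> /forall_inP /(_ u uS) /eqP [].
Qed.

(** Makes the default of the [arg min] in [gamma_x2] admissible, so that the minimum is attained by
    a double dominating set. *)
Lemma double_dominating_setT :
  irreflexive e -> 0 < min_indeg e -> double_dominating e [set: T].
Proof.
move=> e_irr min_gt0; apply/forallP => v.
have -> : [set u in [set: T] | dominates e u v] = v |: [set u | e u v].
  by apply/setP=> u; rewrite !inE.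
by rewrite cardsU1 inE e_irr ltnS (leq_trans min_gt0 (min_indeg_le v)).
Qed.

Lemma gamma_x2P :
  irreflexive e -> 0 < min_indeg e ->
  (exists2 S, double_dominating e S & gamma_x2 e = #|S|) /\
  (forall S, double_dominating e S -> gamma_x2 e <= #|S|).
Proof.
move=> e_irr min_gt0; rewrite /gamma_x2.
case: arg_minnP => [|S dS minS]; first exact: double_dominating_setT.
by split=> //; exists S.
Qed.

Lemma gamma_x2_lower_bound :
  irreflexive e -> 0 < min_indeg e ->
  2 * #|T| <= gamma_x2 e * (max_outdeg e).+1.
Proof.
move=> e_irr min_gt0; have [[S dS ->] _] := gamma_x2P e_irr min_gt0.
exact: double_dominating_card.
Qed.

End Domination.

(** * Invariance under isomorphism *)

Section Isomorphism.

Variables (T1 T2 : finType) (e1 : rel T1) (e2 : rel T2) (f : T1 -> T2).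
Hypotheses (f_bij : bijective f) (f_arc : forall x y, e2 (f x) (f y) = e1 x y).

Lemma iso_outdeg (x : T1) : outdeg e2 (f x) = outdeg e1 x.
Proof.
rewrite /outdeg -(card_imset _ (bij_inj f_bij)); congr #|pred_of_set _|.
have [g fK gK] := f_bij; apply/setP=> y.
by rewrite -[y]gK (mem_imset _ _ (bij_inj f_bij)) !inE f_arc.
Qed.

Lemma iso_max_outdeg : max_outdeg e2 = max_outdeg e1.
Proof.
rewrite /max_outdeg (reindex f (onW_bij _ f_bij)).
by apply: eq_bigr => x _; apply: iso_outdeg.
Qed.

Lemma iso_double_dominating (S : {set T1}) :
  double_dominating e1 S -> double_dominating e2 (f @: S).
Proof.
move=> /forallP dS; apply/forallP=> y; have [g fK gK] := f_bij.
have f_inj := bij_inj f_bij; rewrite -[y]gK; apply: leq_trans (dS (g y)) _.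
rewrite -(card_imset _ f_inj) subset_leq_card //.
apply/subsetP=> _ /imsetP[x + ->]; rewrite !inE => /andP[xS].
by rewrite (mem_imset _ _ f_inj) xS /dominates (inj_eq f_inj) f_arc.
Qed.

End Isomorphism.

(** Forces [r] to be positive in [Theta], so that [r - 1] is a genuine subtraction. *)
Lemma contrafunctional_max_outdeg (V : finType) (e : rel V) :
  contrafunctional e -> 0 < #|V| -> 0 < max_outdeg e.
Proof.
move=> e_contra /card_gt0P[v _].
have /card_gt0P[u] : 0 < #|[set u | e u v]| by have := e_contra v; rewrite /indeg => ->.
rewrite inE => uv; apply: leq_trans (outdeg_le_max e u).
by apply/card_gt0P; exists v; rewrite inE.
Qed.

(** * Members of Theta attain the bound *)

Section JoinArcs.

Variables (V U : finType) (e : rel V) (a : V -> U -> bool).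
Variables (b : rel U) (c : U -> V -> bool).

Lemma outdeg_attach_arcs (v : V) :
  outdeg (attach_arcs e a) (inl v) = outdeg (join_arcs e a b c) (inl v).
Proof. by apply: eq_card => -[w|u]; rewrite !inE. Qed.

Lemma outdeg_le_join_arcs (v : V) :
  outdeg e v <= outdeg (join_arcs e a b c) (inl v).
Proof.
rewrite /outdeg -(card_imset _ (@inl_inj V U)) subset_leq_card //.
by apply/subsetP=> _ /imsetP[w + ->]; rewrite !inE.
Qed.

(** A vertex of [V] is dominated by itself and by its in-neighbour in [V], a vertex of [U] by the
    two tails of its arcs from [V]. *)
Lemma join_arcs_double_dominating :
  irreflexive e -> contrafunctional e -> (forall u, #|[set v | a v u]| = 2) ->
  double_dominating (join_arcs e a b c) (inl @: [set: V]).
Proof.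
move=> e_irr e_contra a2; have inlI := @inl_inj V U.
apply/forallP=> -[v|u].
  have <- : #|v |: [set w | e w v]| = 2.
    by rewrite cardsU1 inE e_irr; have := e_contra v; rewrite /indeg => ->.
  rewrite -(card_imset _ inlI) subset_leq_card //.
  apply/subsetP=> _ /imsetP[w + ->].
  by rewrite !inE (mem_imset _ _ inlI) inE /dominates (inj_eq inlI).
rewrite -(a2 u) -(card_imset _ inlI) subset_leq_card //.
apply/subsetP=> _ /imsetP[w + ->].
by rewrite !inE (mem_imset _ _ inlI) inE /dominates.
Qed.

End JoinArcs.

(** The copy of [V] has [n'] elements, and [n' * (r + 1) = 2 * n' + (r - 1) * n'] is twice the order
    because [q] is even. So this set meets the lower bound. *)
Lemma Theta_gamma_x2 (T : finType) (e : rel T) :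
  irreflexive e -> 0 < min_indeg e -> Theta e ->
  gamma_x2 e * (max_outdeg e).+1 = 2 * #|T|.
Proof.
move=> e_irr min_gt0 [n' [e' [r /= [e'_irr e'_contra le_r q_even]]]].
move=> [a [b [c [a2 _ _ max_r [f f_bij f_arc]]]]].
have cardT : #|T| = n' + ((r - 1) * n')./2.
  by rewrite -(bij_eq_card f_bij) card_sum !card_ord.
have n'_gt0 : 0 < n'.
  by have := min_indeg_gt0_card min_gt0; rewrite cardT; case: (n') => //; rewrite muln0.
have r_gt0 : 0 < r.
  by apply: leq_trans le_r; apply: contrafunctional_max_outdeg; rewrite ?card_ord.
have max_e : max_outdeg e = r by rewrite (iso_max_outdeg f_bij f_arc).
have dS := iso_double_dominating f_bij f_arc
  (join_arcs_double_dominating b c e'_irr e'_contra a2).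
have [_ /(_ _ dS)] := gamma_x2P e_irr min_gt0.
rewrite (card_imset _ (bij_inj f_bij)) (card_imset _ (@inl_inj _ _)) cardsT card_ord.
move=> gamma_le; apply/eqP; rewrite eqn_leq gamma_x2_lower_bound // andbT max_e.
apply: leq_trans (leq_mul gamma_le (leqnn _)) _.
rewrite cardT mulnDr [2 * _./2]mul2n even_halfK //.
by case: (r) r_gt0 => // s _; nia.
Qed.

(** * Splitting a digraph along a vertex set *)

Section Decomposition.

Variables (T : finType) (e : rel T) (S : {set T}) (m : nat).
Hypotheses (e_irr : irreflexive e) (m_card : m = #|~: S|).

(** [Theta] indexes the new vertices by ['I_(q./2)], and [q./2] is only provably equal to [#|~: S|];
    hence the free [m] and the cast. *)
Definition glue (x : 'I_#|S| + 'I_m) : T :=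
  match x with
  | inl i => enum_val i
  | inr j => enum_val (cast_ord m_card j)
  end.

Lemma glue_inl_in (i : 'I_#|S|) : glue (inl i) \in S.
Proof. exact: enum_valP. Qed.

Lemma glue_inr_notin (j : 'I_m) : glue (inr j) \notin S.
Proof. by have := enum_valP (cast_ord m_card j); rewrite inE. Qed.

Lemma glue_bij : bijective glue.
Proof.
apply: inj_card_bij => [x y|]; last by rewrite card_sum !card_ord m_card cardsC.
case: x y => [i|j] [i'|j'] eq_xy.
- by rewrite (enum_val_inj eq_xy).
- by have := glue_inr_notin j'; rewrite -eq_xy glue_inl_in.
- by have := glue_inr_notin j; rewrite eq_xy glue_inl_in.
- by rewrite (cast_ord_inj (enum_val_inj eq_xy)).
Qed.

(** Moves the in-degree counts required by [Theta], taken over indices, back to counts inside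
    [S]. *)
Lemma card_glue_inl (P : pred T) :
  #|[set i | P (glue (inl i))]| = #|[set u in S | P u]|.
Proof.
have inlI : injective (fun i => glue (inl i)) by exact: enum_val_inj.
rewrite -(card_imset _ inlI); congr #|pred_of_set _|.
apply/setP=> u; apply/imsetP/idP => [[i + ->]|].
  by rewrite !inE glue_inl_in.
rewrite inE => /andP[uS Pu].
by exists (enum_rank_in uS u); rewrite ?inE /= enum_rankK_in.
Qed.

(** One of the two dominators is [v] itself, which is not its own in-neighbour. *)
Lemma dominated_twice_inside (v : T) :
  v \in S -> #|[set u in S | dominates e u v]| = 2 ->
  #|[set u in S | e u v]| = 1.
Proof.
move=> vS; have -> : [set u in S | dominates e u v] = v |: [set u in S | e u v].
  apply/setP=> u; rewrite !inE /dominates.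
  by case: (eqVneq u v) => [->|//]; rewrite vS.
by rewrite cardsU1 inE e_irr andbF => -[].
Qed.

Lemma dominated_twice_outside (v : T) :
  v \notin S -> #|[set u in S | dominates e u v]| = 2 ->
  #|[set u in S | e u v]| = 2.
Proof.
move=> vS <-; apply: eq_card => u; rewrite !inE /dominates.
by case: (eqVneq u v) => [->|//]; rewrite (negPf vS).
Qed.

End Decomposition.

Lemma tight_Theta (T : finType) (e : rel T) :
  irreflexive e -> 0 < min_indeg e ->
  gamma_x2 e * (max_outdeg e).+1 = 2 * #|T| -> Theta e.
Proof.
move=> e_irr min_gt0; have [[S dS ->] _] := gamma_x2P e_irr min_gt0 => tight.
have [dom2 out_max] := double_dominating_tight e_irr dS tight.
set r := max_outdeg e in tight out_max *.
have r_gt0 : 0 < r.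
  have /card_gt0P[v _] := min_indeg_gt0_card min_gt0.
  have /card_gt0P[u] := leq_trans min_gt0 (min_indeg_le e v).
  rewrite inE => uv; apply: leq_trans (outdeg_le_max e u).
  by apply/card_gt0P; exists v; rewrite inE.
(* Subtract [2 * #|S|] from both sides of [#|S| * (r + 1) = 2 * (#|S| + #|~: S|)]. This gives both
   the parity of [q] and the number of new vertices. *)
have q_eq : (r - 1) * #|S| = (#|~: S|).*2.
  by have := cardsC S; case: (r) r_gt0 tight => // s _; nia.
have m_card : ((r - 1) * #|S|)./2 = #|~: S| by rewrite q_eq doubleK.
pose g := glue m_card; have g_bij : bijective g := glue_bij m_card.
(* The four blocks of [e] for the partition of the vertices into [S] and its complement. *)
pose e' i i' := e (g (inl i)) (g (inl i')); pose a i j := e (g (inl i)) (g (inr j)).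
pose b j j' := e (g (inr j)) (g (inr j')); pose c j i := e (g (inr j)) (g (inl i)).
have g_arc x y : e (g x) (g y) = join_arcs e' a b c x y by case: x y => [i|j] [].
have out_inl i : outdeg (join_arcs e' a b c) (inl i) = r.
  by rewrite -(iso_outdeg g_bij g_arc) out_max // glue_inl_in.
exists #|S|, e', r; split.
- by move=> i; apply: e_irr.
- move=> i; rewrite /indeg (card_glue_inl m_card (fun u => e u (g (inl i)))).
  by apply: dominated_twice_inside; rewrite ?glue_inl_in.
- apply/bigmax_leqP => i _; rewrite -(out_inl i).
  exact: outdeg_le_join_arcs.
- by rewrite q_eq odd_double.
exists a, b, c; split.
- move=> j; rewrite (card_glue_inl m_card (fun u => e u (g (inr j)))).
  by apply: dominated_twice_outside; rewrite ?glue_inr_notin.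
- by move=> i; rewrite (outdeg_attach_arcs _ _ b c).
- by move=> j; apply: e_irr.
- by rewrite -(iso_max_outdeg g_bij g_arc).
- by exists g.
Qed.

(** * From natural numbers to the rational quotient *)

Local Open Scope ring_scope.

Import GRing.Theory Num.Theory.

Theorem theorem3 (T : finType) (e : rel T) (e_irr : irreflexive e)
    (min_indeg_ge1 : (1 <= min_indeg e)%N) :
  (2%:R * #|T|%:R / ((max_outdeg e)%:R + 1) <= (gamma_x2 e)%:R :> rat) /\
  ((gamma_x2 e)%:R = 2%:R * #|T|%:R / ((max_outdeg e)%:R + 1) :> rat <->
   Theta e).
Proof.
rewrite natr1 -natrM; have D_gt0 : 0 < (max_outdeg e).+1%:R :> rat by rewrite ltr0n.
split; first by rewrite ler_pdivrMr // -natrM ler_nat gamma_x2_lower_bound.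
have D_neq0 : (max_outdeg e).+1%:R != 0 :> rat by rewrite pnatr_eq0.
split=> [/eqP | theta].
  (* Multiplying by the nonzero denominator turns the equality into the one on [nat]. *)
  rewrite -(inj_eq (mulIf D_neq0)) divfK // -natrM eqr_nat => /eqP.
  exact: tight_Theta.
by apply: (mulIf D_neq0); rewrite divfK // -natrM Theta_gamma_x2.
Qed.
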